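(* Let $p>1$ and $0<u<p$ be real, $d$ a positive integer, and $\mu$ a partition with $r(\mu)$ parts. Then the $\mu$-moment of $P_{d,u}$, \[ \sum_{\lambda}P_{d,u}(\lambda)\,|{\rm Sur}(\lambda,\mu)|, \] equals $\dfrac{u^{|\mu|}(1/p)_d}{(1/p)_{d-r(\mu)}}$ if $r(\mu)\le d$, and $0$ otherwise.
   Context: Write $(x)_i=(1-x)(1-x/p)\cdots(1-x/p^{i-1})$ (with $(x)_0=1$). For a partition $\lambda$: $|\lambda|=\sum\lambda_i$, $m_i(\lambda)$ is the number of parts equal to $i$, $\lambda_i'$ is the length of the $i$-th column of its diagram, and $r(\lambda)=\lambda_1'$ its number of parts. The probability measure $P_{d,u}$ on partitions is $P_{d,u}(\lambda)=\frac{u^{|\lambda|}}{p^{\sum_i(\lambda_i')^2}\prod_i (1/p)_{m_i(\lambda)}}\prod_{i=1}^d(1-u/p^i)\prod_{i=d-r(\lambda)+1}^d(1-1/p^i)$ if $r(\lambda)\le d$, and $0$ otherwise. Set $|{\operatorname{Aut}}(\mu)|=p^{\sum_i(\mu_i')^2}\prod_i(1/p)_{m_i(\mu)}$. For a prime $\ell$, the number of subgroups of type $\mu$ in a finite abelian $\ell$-group of type $\lambda$ (i.e. isomorphic to $\prod_i\mathbb{Z}/\ell^{\lambda_i}\mathbb{Z}$) is given by a polynomial $n_\lambda(\mu)$ evaluated at $\ell$; for real $p>1$, $n_\lambda(\mu)$ denotes this polynomial evaluated at $p$, and $|{\rm Sur}(\lambda,\mu)|:=n_\lambda(\mu)\,|{\operatorname{Aut}}(\mu)|$.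 When $p$ is prime, $|{\rm Sur}(\lambda,\mu)|$ is the number of surjective homomorphisms from a finite abelian $p$-group of type $\lambda$ onto one of type $\mu$. *)

(* Defs.v *)
From HB Require Import structures.
From mathcomp Require Import all_boot all_order all_algebra all_fingroup.
From mathcomp Require Import finmap.
From mathcomp Require Import all_classical all_reals all_analysis.
From mathcomp.analysis.showcase Require Import summability.

Set Implicit Arguments.
Unset Strict Implicit.
Unset Printing Implicit Defensive.

Import Order.TTheory GRing.Theory Num.Theory.
Import numFieldNormedType.Exports.

Local Open Scope ring_scope.

Record intpart := IntPart {
  parts :> seq nat;
  _ : sorted geq parts && (0%N \notin parts) }.

HB.instance Definition _ := [isSub for parts].
HB.instance Definition _ := [Countable of intpart by <:].

Definition weight (la : intpart) : nat := sumn la.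
Definition largest (la : intpart) : nat := head 0%N la.
Definition partmult (la : intpart) (i : nat) : nat := count_mem i la.
Definition column (la : intpart) (i : nat) : nat := count (leq i) la.
Definition nparts (la : intpart) : nat := column la 1.

(* 'Z_n is Z/nZ only for n > 1, which holds for l prime as all parts are
   positive; the group law on each factor is addition. *)
Notation abgroup l la :=
  {dffun forall i : 'I_(size (parts la)), 'Z_(l ^ nth 0%N (parts la) i)}.

Definition nsubgroups (l : nat) (la mu : intpart) : nat :=
  #|[set H : {group abgroup l la} | H \isog [set: abgroup l mu]]|.

Section Moments.
Variable R : realType.

Definition poch (p x : R) (n : nat) : R := \prod_(i < n) (1 - x / p ^+ i).

Definition is_subgroup_poly (la mu : intpart) (f : {poly R}) : Prop :=
  forall l : nat, prime l -> f.[l%:R] = (nsubgroups l la mu)%:R.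

(* There is at most one such polynomial; 0 is a junk value. *)
Definition subgroup_poly (la mu : intpart) : {poly R} :=
  xget 0 [set f | is_subgroup_poly la mu f]%classic.

Lemma is_subgroup_poly_unique (la mu : intpart) (f g : {poly R}) :
  is_subgroup_poly la mu f -> is_subgroup_poly la mu g -> f = g.
Proof.
move=> hf hg; apply/eqP; rewrite -subr_eq0; apply/negPn/negP => nz.
have [s [us ps ss]] : exists s : seq nat,
    [/\ uniq s, all prime s & size s = size (f - g)].
  elim: (size _) => [|n [s [us ps ss]]]; first by exists [::].
  have [q ltq pq] := prime_above (\max_(i <- s) i).
  exists (q :: s); rewrite /= us ps pq ss andbT; split=> //.
  apply/negP => qs; move: ltq; rewrite ltnNge => /negP; apply.
  exact: (@leq_bigmax_seq _ s xpredT id).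
suff : (size [seq l%:R : R | l <- s] < size (f - g)%R)%N.
  by rewrite size_map ss ltnn.
apply: max_poly_roots => //; last first.
  by rewrite map_inj_uniq //; apply: mulrIn; rewrite oner_eq0.
apply/allP => _ /mapP[l /(allP ps) pl ->].
by rewrite /root hornerD hornerN hf // hg // subrr.
Qed.

Variable p : R.

Definition autcard (mu : intpart) : R :=
  p ^+ (\sum_(1 <= i < (largest mu).+1) column mu i ^ 2)
  * \prod_(1 <= i < (largest mu).+1) poch p p^-1 (partmult mu i).

Definition surcard (la mu : intpart) : R := (subgroup_poly la mu).[p] * autcard mu.

Definition Pdu (d : nat) (u : R) (la : intpart) : R :=
  if (nparts la <= d)%N then
    u ^+ weight la / autcard la
    * \prod_(1 <= i < d.+1) (1 - u / p ^+ i)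
    * \prod_((d - nparts la).+1 <= i < d.+1) (1 - 1 / p ^+ i)
  else 0.

End Moments.

(* Main.v *)
Require Import Defs.
From mathcomp Require Import all_boot all_order all_algebra all_fingroup.
From mathcomp Require Import all_solvable finmap zify ring lra.

(** For a prime [l], an injection of the group of type [mu] into the group of
    type [la] is a choice of images of the generators, made in order of
    decreasing order: the [j]-th image is any [l^k]-torsion element, [k = mu_j],
    whose [l^(k-1)]-th power avoids the span of the previous images.  This gives
    [prod_j (l^A(k) - l^(j + A(k-1)))] injections, where [l^A(k)] is the order of
    the [l^k]-torsion, [A(k) = la'_1 + ... + la'_k].  The number of subgroups of
    type [mu] is the quotient of this polynomial in [l] by the same polynomial for
    [la = mu], which is monic; as the quotient is an integer at every prime, the
    remainder of the polynomial division vanishes.  Hence [|Sur(la, mu)|] is the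
    above product at [l = p] for every real [p].

    In terms of the column lengths [c_i = la'_i] the summand is then a product of
    factors depending on [(c_(i-1), c_i)], with [c_0 = d], and the sum over one
    column length is evaluated by a finite q-Chu-Vandermonde identity.  Once the
    columns of [mu] are exhausted, the column lengths form a Markov chain absorbed
    at [0], so the truncated sums converge geometrically. *)

Set Implicit Arguments.
Unset Strict Implicit.
Unset Printing Implicit Defensive.

Notation abgrp l m := {dffun forall i : 'I_(size m), 'Z_(l ^ nth 0%N m i)}.

(** * Subgroups of a given type in a finite abelian l-group *)

Section SubgroupCount.
Import GroupScope.

Section Independent.
Variables (gT : finGroupType) (l : nat).
Hypotheses (l_prime : prime l) (abT : abelian [set: gT]).

(* [y] generates a subgroup of type [s], the elements of [y] being a basis; to
   peel off the last chosen generator, [s] lists the smallest part first. *)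
Fixpoint indep (s : seq nat) (y : seq gT) : bool :=
  match s, y with
  | [::], [::] => true
  | k :: s', z :: y' =>
      [&& indep s' y', z ^+ (l ^ k) == 1
        & z ^+ (l ^ k.-1) \notin <<[set x in y']>>]
  | _, _ => false
  end.

Let mulgC (x y : gT) : commute x y.
Proof. by apply: (centsP abT); rewrite inE. Qed.

Lemma abelian_subT (H : {group gT}) : abelian H.
Proof. exact: abelianS (subsetT _) abT. Qed.

(** Each new generator [z] splits off a direct factor: the socle of [<[z]>] has order [l] and is
    generated by [z ^+ (l ^ k.-1)], which avoids the earlier span. The last clause, lifting socle
    elements to roots, feeds the count of extensions. *)
Lemma indep_span (s : seq nat) (y : seq gT) :
  all (leq 1) s -> indep s y ->
  [/\ size y = size s, #|<<[set x in y]>>| = (\prod_(k <- s) l ^ k)%N,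
      #|'Ohm_1(<<[set x in y]>>)| = (l ^ size s)%N
    & forall k, 0 < k -> all (leq k) s -> forall h, h \in 'Ohm_1(<<[set x in y]>>) ->
      exists2 x, x ^+ (l ^ k) = 1 & x ^+ (l ^ k.-1) = h].
Proof.
elim: s y => [|k s IHs] [|z y] //=.
  move=> _ _; have -> : <<[set x in [::]]>> = 1 :> {set gT}.
    by apply/trivgP; rewrite gen_subG; apply/subsetP => x; rewrite !inE.
  rewrite Ohm1 cards1 big_nil; split=> // k _ _ h /set1P->.
  by exists 1; rewrite expg1n.
case/andP=> k_gt0 s_gt0 /and3P[/(IHs _ s_gt0)[<- cardH cardO liftO] /eqP z1 zH].
set H := <<[set x in y]>> in cardH cardO liftO zH *.
have l_gt1 := prime_gt1 l_prime.
(* A smaller order would make [z ^+ (l ^ k.-1)] trivial, hence a member of [H]. *)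
have oz : #[z] = (l ^ k)%N.
  have /dvdn_pfactor-/(_ l_prime)[m lemk om] : #[z] %| (l ^ k)%N by rewrite order_dvdn z1.
  suff -> : k = m by [].
  apply/eqP; rewrite eqn_leq lemk andbT leqNgt; apply/negP => ltmk.
  case/negP: zH; suff -> : z ^+ (l ^ k.-1) = 1 by rewrite group1.
  by apply/eqP; rewrite -order_dvdn om dvdn_exp2l // -ltnS prednK.
have zl : l.-elt z by rewrite /p_elt oz pnatX pnat_id.
have Oz : 'Ohm_1(<[z]>) = <[z ^+ (l ^ k.-1)]>.
  by rewrite (Ohm_p_cycle 1 zl) oz pfactorK // subn1.
have cardOz : #|'Ohm_1(<[z]>)| = l.
  rewrite Oz -orderE orderXgcd oz.
  have {1 2}-> : k = k.-1.+1 by rewrite prednK.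
  by rewrite (gcdn_idPr _) expnS ?dvdn_mull // mulnK // expn_gt0 ltnW.
have TI : <[z]> :&: H = 1.
  rewrite setIC; apply: TI_Ohm1; rewrite setIC; apply: prime_TIg; first by rewrite cardOz.
  by rewrite /= Oz cycle_subG.
have defHz : H \x <[z]> = <<[set x in z :: y]>>.
  rewrite dprodEY 1?setIC //; last first.
    by apply: sub_abelian_cent2 abT _ _; rewrite subsetT.
  rewrite joing_idl joing_idr /joing; congr <<_>>.
  by apply/setP => x; rewrite !inE orbC.
split=> //.
- by rewrite -(dprod_card defHz) cardH big_cons -orderE oz mulnC.
- by rewrite -(dprod_card (Ohm_dprod 1 defHz)) cardO cardOz expnS mulnC.
move=> m m_gt0 /andP[lemk les] h.
case/(mem_dprod (Ohm_dprod 1 defHz)) => h1 [h2 [/(liftO _ m_gt0 les)[x x1 <-]]].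
rewrite Oz => /cycleP[i ->] [-> _].
have e1 : (l ^ (k - m) * l ^ m.-1 = l ^ k.-1)%N by rewrite -expnD; congr (_ ^ _)%N; lia.
have e2 : (l ^ (k - m) * l ^ m = l ^ k)%N by rewrite -expnD; congr (_ ^ _)%N; lia.
(* The [<[z]>]-component of [h] is a power of [z ^+ (l ^ k.-1)]; since [m <= k], the factor
   [l ^ (k - m)] exhibits it as an [l ^ m.-1]-th power. *)
exists (x * z ^+ (i * l ^ (k - m))%N).
  by rewrite expgMn // x1 -expgM -mulnA e2 mulnC expgM z1 expg1n mul1g.
by rewrite expgMn // -expgM -mulnA e1 -expgM mulnC.
Qed.

(** The torsion elements left out, those with [z ^+ (l ^ k.-1)] in [H], are fibred by this power
    over ['Ohm_1(H)]. Each fibre is nonempty by the lifting hypothesis, hence a coset of the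
    [l ^ k.-1]-torsion. *)
Lemma card_indep_ext (H : {group gT}) m k :
  0 < k -> l.-group H -> #|'Ohm_1(H)| = (l ^ m)%N ->
  (forall h, h \in 'Ohm_1(H) -> exists2 x, x ^+ (l ^ k) = 1 & x ^+ (l ^ k.-1) = h) ->
  (#|[set z : gT | (z ^+ (l ^ k) == 1%g) && (z ^+ (l ^ k.-1) \notin H)]|
    + l ^ m * #|'Ldiv_(l ^ k.-1)([set: gT])|)%N = #|'Ldiv_(l ^ k)([set: gT])|.
Proof.
move=> k_gt0 lH cardO liftO.
have OE : 'Ohm_1(H) = 'Ldiv_l(H) by rewrite (OhmEabelian lH) ?expn1 // abelian_subT.
rewrite -(cardsID [set z | z ^+ (l ^ k.-1) \in H] 'Ldiv_(l ^ k)(_)) addnC.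
congr addn; last first.
  by apply: eq_card => z; rewrite !inE andbC.
rewrite -[RHS]sum1_card.
rewrite (partition_big (fun z => z ^+ (l ^ k.-1)) (mem 'Ohm_1(H))) /=; last first.
  move=> z /setIP[/setIP[_]]; rewrite !inE => /eqP z1 zH; rewrite OE.
  by apply/setIP; rewrite inE -expgM -expnSr prednK // z1.
transitivity (\sum_(h in 'Ohm_1(H)) #|'Ldiv_(l ^ k.-1)([set: gT])|)%N.
  by rewrite sum_nat_const cardO.
apply: eq_bigr => h hO; have [x x1 xh] := liftO h hO.
have /= := card_imset (mem 'Ldiv_(l ^ k.-1)([set: gT])) (mulgI x).
move=> <-; rewrite sum1_card; apply: eq_card => z; rewrite [RHS]unfold_in /= !in_setI !inE /=.
have [hH hl]: h \in H /\ h ^+ l = 1 by move: hO; rewrite OE => /LdivP.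
apply/imsetP/idP => [[w /LdivP[_ w1] ->]|/andP[_ /eqP zh]].
  rewrite !expgMn // x1 mul1g xh w1 mulg1 hH eqxx !andbT.
  by rewrite -(prednK k_gt0) expnSr expgM w1 expg1n.
exists (x^-1 * z); last by rewrite mulKVg.
by apply/LdivP; rewrite inE expgMn // expgVn xh zh mulVg.
Qed.

Definition nindep (s : seq nat) : nat := #|[set y : (size s).-tuple gT | indep s y]|.

(** The number of admissible [z] is the same for every independent [y]. The additive form avoids
    truncated subtraction. *)
Lemma nindep_cons k s : all (leq 1) s -> 0 < k -> all (leq k) s ->
  (nindep (k :: s) + nindep s * (l ^ size s * #|'Ldiv_(l ^ k.-1)([set: gT])|)
   = nindep s * #|'Ldiv_(l ^ k)([set: gT])|)%N.
Proof.
move=> s_gt0 k_gt0 les.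
have -> : nindep (k :: s) = (\sum_(y : (size s).-tuple gT | indep s y)
    #|[set z : gT | (z ^+ (l ^ k) == 1%g) && (z ^+ (l ^ k.-1) \notin <<[set x in y]>>)]|)%N.
  rewrite /nindep -sum1_card.
  under [RHS]eq_bigr do rewrite -sum1_card.
  rewrite (pair_big_dep (fun y => indep s (val y)) (fun y z => _)) /=.
  rewrite (reindex (fun yz : (size s).-tuple gT * gT => [tuple of yz.2 :: yz.1])) /=.
    by apply: eq_bigl => -[y z]; rewrite !inE.
  exists (fun t : (size s).+1.-tuple gT => ([tuple of behead t], thead t)) => [[y z] _|t _] /=.
    by rewrite theadE; congr pair; apply: val_inj.
  by rewrite [RHS]tuple_eta.
have -> : nindep s = (\sum_(y : (size s).-tuple gT | indep s y) 1)%N.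
  by rewrite sum1dep_card.
rewrite !big_distrl -big_split /=.
apply: eq_bigr => y iy; rewrite !mul1n.
have [_ cH cO lift] := indep_span s_gt0 iy.
apply: card_indep_ext => //; last exact: lift.
rewrite /pgroup cH; elim: (s) => [|a t IHt]; rewrite ?big_nil ?big_cons //.
by rewrite pnatM IHt pnatX pnat_id.
Qed.

End Independent.
Definition nbasis (gT : finGroupType) l (s : seq nat) (G : {set gT}) : nat :=
  #|[set y : (size s).-tuple gT | indep l s y && (<<[set x in y]>> == G)]|.

Section Transport.
Variables (gT rT : finGroupType) (l : nat).

Lemma morphim_span (H : {group gT}) (f : {morphism H >-> rT}) (y : seq gT) :
  {subset y <= H} -> f @* <<[set x in y]>> = <<[set x in map f y]>>.
Proof.
move=> yH; rewrite morphim_gen; last by apply/subsetP => x; rewrite inE => /yH.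
congr <<_>>; apply/setP => z; rewrite inE; apply/morphimP/mapP => [[x _]|[x xy ->]].
  by rewrite inE => xy ->; exists x.
by exists x; rewrite ?inE // yH.
Qed.

Lemma indep_morphim (H : {group gT}) (f : {morphism H >-> rT}) s (y : seq gT) :
  'injm f -> {subset y <= H} -> indep l s y -> indep l s (map f y).
Proof.
move=> injf; elim: s y => [|k s IHs] [|z y] //= yH /and3P[iy /eqP z1 zy].
have zH : z \in H by rewrite yH ?inE ?eqxx.
have {}yH : {subset y <= H} by move=> x xy; rewrite yH // inE xy orbT.
rewrite IHs // -!morphX // z1 morph1 eqxx -morphim_span //=.
rewrite -(injmK injf (_ : <<[set x in y]>> \subset H)) in zy; last first.
  by rewrite gen_subG; apply/subsetP => x; rewrite inE => /yH.
by apply: contra zy => zy; apply/morphpreP; rewrite groupX.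
Qed.

Lemma leq_nbasis s (H : {group gT}) (K : {group rT}) :
  H \isog K -> nbasis l s H <= nbasis l s K.
Proof.
case/isogP => f injf imf; rewrite /nbasis.
set A := [set y | _ ]; set B := [set y | _].
have AH (y : (size s).-tuple gT) : y \in A -> {subset y <= H}.
  by rewrite inE => /andP[_ /eqP <-] x xy; rewrite mem_gen ?inE.
rewrite -(card_in_imset (_ : {in A &, injective (fun y => map_tuple f y)})).
  apply/subset_leq_card/subsetP => _ /imsetP[y yA ->].
  rewrite inE /= -(morphim_span _ (AH y yA)).
  move: (yA); rewrite inE => /andP[iy /eqP ->]; rewrite imf eqxx andbT.
  exact: indep_morphim injf (AH y yA) iy.
move=> y1 y2 /AH y1H /AH y2H /(congr1 val) /= e.
apply: eq_from_tnth => i; apply: (injmP injf); [exact/y1H/mem_tnth | exact/y2H/mem_tnth |].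
by rewrite !(tnth_nth 1) -(nth_map _ 1 f) ?size_tuple // e (nth_map 1) ?size_tuple.
Qed.

End Transport.

Lemma isog_nbasis (gT rT : finGroupType) l s (H : {group gT}) (K : {group rT}) :
  H \isog K -> nbasis l s H = nbasis l s K.
Proof.
by move=> iHK; apply/eqP; rewrite eqn_leq !leq_nbasis // isog_sym.
Qed.

Section TypeGroup.
Variables (l : nat) (m : seq nat).
Hypotheses (l_prime : prime l) (m_gt0 : all (leq 1) m).

Lemma type_gt1 (i : 'I_(size m)) : 1 < (l ^ nth 0 m i)%N.
Proof.
rewrite -[X in X < _](exp1n (nth 0 m i)) ltn_exp2r ?prime_gt1 //.
exact: (allP m_gt0) (mem_nth _ _).
Qed.

Lemma abgrp_abelian : abelian [set: abgrp l m].
Proof.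
apply/centsP => x _ y _; apply/ffunP => i; rewrite !ffunE.
exact: (centsP (Zp_abelian _)) (in_setT _) _ (in_setT _).
Qed.

Lemma card_abgrp : #|[set: abgrp l m]| = (\prod_(k <- m) l ^ k)%N.
Proof.
have -> : [set: abgrp l m] = setXn (fun i : 'I_(size m) => [set: 'Z_(l ^ nth 0%N m i)]).
  by apply/setP => x; rewrite inE; apply/esym/setXnP => i; rewrite inE.
rewrite cardsXn (big_nth 0) big_mkord; apply: eq_bigr => i _.
by rewrite cardsT card_ord Zp_cast // type_gt1.
Qed.

Lemma card_Ldiv_cycle (gT : finGroupType) (x : gT) a k : #[x] = (l ^ a)%N ->
  #|'Ldiv_(l ^ k)(<[x]>)| = (l ^ minn k a)%N.
Proof.
move=> ox; have xl : l.-elt x by rewrite /p_elt ox pnatX pnat_id.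
rewrite -(OhmEabelian (p := l)) ?(abelianS (Ohm_sub _ _) (cycle_abelian x)) //.
rewrite (Ohm_p_cycle _ xl) -orderE orderXgcd ox pfactorK //.
rewrite (gcdn_idPr _) ?dvdn_exp2l ?leq_subr //.
by rewrite -expnB ?prime_gt0 ?leq_subr //; congr (_ ^ _)%N; lia.
Qed.

Lemma card_Ldiv_Zp a k : 0 < a ->
  #|'Ldiv_(l ^ k)([set: 'Z_(l ^ a)])| = (l ^ minn k a)%N.
Proof.
move=> a_gt0.
have la_gt1 : 1 < (l ^ a)%N by rewrite -[X in X < _](exp1n a) ltn_exp2r ?prime_gt1.
rewrite -(card_Ldiv_cycle (x := Zp1 : 'Z_(l ^ a))) ?order_Zp1 ?Zp_cast //.
by apply: eq_card => z; rewrite !inE -Zp_cycle inE.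
Qed.

Lemma card_Ldiv_abgrp k :
  #|'Ldiv_(l ^ k)([set: abgrp l m])| = (l ^ sumn (map (minn k) m))%N.
Proof.
have -> : 'Ldiv_(l ^ k)([set: abgrp l m])
    = setXn (fun i : 'I_(size m) => 'Ldiv_(l ^ k)([set: 'Z_(l ^ nth 0%N m i)])).
  have ffunX (x : abgrp l m) n i : (x ^+ n) i = x i ^+ n.
    by elim: n => [|n IHn]; rewrite ?expg0 ?expgS ffunE ?IHn.
  apply/setP => x; rewrite in_setI in_setT inE /=; apply/eqP/setXnP => [x1 i|x1].
    by apply/LdivP; rewrite inE -ffunX x1 ffunE.
  by apply/ffunP => i; rewrite ffunX ffunE; have /LdivP[] := x1 i.
rewrite cardsXn sumnE big_map (big_nth 0) big_mkord expn_sum.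
apply: eq_bigr => i _; apply: card_Ldiv_Zp.
exact: (allP m_gt0) (mem_nth _ _).
Qed.

Variable gT : finGroupType.
Hypothesis abT : abelian [set: gT].

Lemma indep_nth s (y : seq gT) i :
  indep l s y -> i < size s -> nth 1 y i ^+ (l ^ nth 0%N s i) = 1.
Proof.
elim: s y i => [|k s IHs] [|z y] // [|i] /= /and3P[iy /eqP z1 _] //.
by rewrite ltnS; apply: IHs.
Qed.

(** The product map [phi] is a morphism because each generator has the right torsion. It is onto the
    span, and equality of orders makes it injective. *)
Lemma span_isog (y : seq gT) :
  indep l (rev m) y -> <<[set x in y]>> \isog [set: abgrp l m].
Proof.
move=> iy; have mr_gt0 : all (leq 1) (rev m) by rewrite all_rev.
have [sz cy _ _] := indep_span l_prime abT mr_gt0 iy; rewrite size_rev in sz.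
pose g (i : 'I_(size m)) := nth 1 (rev y) i.
have gy i : g i \in [set x in y].
  by rewrite inE -mem_rev mem_nth // size_rev sz.
have g1 i : g i ^+ (l ^ nth 0%N m i) = 1.
  have -> : nth 0%N m i = nth 0%N (rev m) (size m - i.+1).
    by rewrite nth_rev; [congr nth | ]; have := ltn_ord i; lia.
  rewrite /g (nth_rev 1) ?sz //; rewrite (indep_nth iy) // size_rev.
  by have := ltn_ord i; lia.
pose phi (a : abgrp l m) := \prod_i g i ^+ (a i).
have phiM : {in [set: abgrp l m] &, {morph phi : a b / a * b}}.
  move=> a b _ _; rewrite /phi.
  elim/big_rec3: _ => [|i x1 x2 x3 _ ->]; first by rewrite mulg1.
  have -> : g i ^+ (a * b)%g i = g i ^+ a i * g i ^+ b i.
    rewrite -expgD -[RHS](expg_mod _ (g1 i)) ffunE /=.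
    by rewrite [X in _ %% X]Zp_cast ?type_gt1.
  rewrite -!mulgA; congr (_ * _); rewrite !mulgA; congr (_ * _).
  by apply: (centsP abT); rewrite inE.
pose f := Morphism phiM.
have imf : f @* [set: abgrp l m] = <<[set x in y]>>.
  apply/eqP; rewrite eqEsubset; apply/andP; split.
    apply/subsetP => _ /morphimP[a _ _ ->]; rewrite /= /phi group_prod // => i _.
    by rewrite groupX // mem_gen.
  rewrite gen_subG; apply/subsetP => x; rewrite inE -mem_rev => /(nthP 1)[j].
  rewrite size_rev sz => ltj <-.
  pose i := Ordinal ltj.
  have -> : nth 1 (rev y) j = f (dfung1 (1%R : 'Z_(l ^ nth 0%N m i))).
    rewrite /= /phi (big_only1 i) //=.
      rewrite dfung1_id /= modn_small ?expg1 //.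
    by move=> k ki _; rewrite dfung1_dflt // eq_sym.
  by rewrite mem_morphim ?inE.
rewrite isog_sym; apply/isogP; exists f => //.
by rewrite -card_im_injm imf cy card_abgrp (perm_big m) ?perm_rev.
Qed.

(** Sort the independent tuples by their span: it always has type [m], and all subgroups of type [m]
    have equally many bases. *)
Lemma nindep_nsub :
  nindep gT l (rev m)
  = (#|[set H : {group gT} | H \isog [set: abgrp l m]]|
     * nbasis l (rev m) [set: abgrp l m])%N.
Proof.
rewrite /nindep -sum1dep_card.
rewrite (partition_big (fun y : (size (rev m)).-tuple gT => <<[set x in y]>>%G)
  (fun H : {group gT} => H \isog [set: abgrp l m])) /=; last by move=> y; apply: span_isog.
rewrite -sum1dep_card big_distrl /=; apply: eq_bigr => H isoH.
rewrite mul1n -(isog_nbasis l (rev m) (_ : H \isog [group of [set: abgrp l m]])) //.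
by rewrite sum1dep_card; apply: eq_card => y; rewrite !inE.
Qed.

End TypeGroup.

(** Applied to the group of type [mu] itself, where it identifies [nbasis] with the number of
    independent tuples. *)
Lemma nsub_self (gT : finGroupType) :
  #|[set H : {group gT} | H \isog [set: gT]]| = 1%N.
Proof.
apply/eqP/cards1P; exists [group of [set: gT]]; apply/setP => H; rewrite !inE.
apply/idP/eqP => [/card_isog cH|->]; last exact: isog_refl.
by apply: val_inj; apply/eqP; rewrite eqEcard subsetT cH /=.
Qed.
End SubgroupCount.

(* Imported only here: [classical_sets] shadows the [finset] lemmas used above. *)
From mathcomp Require Import all_classical all_reals all_analysis.
From mathcomp.analysis.showcase Require Import summability.

Import Order.TTheory GRing.Theory Num.Theory.
Import numFieldNormedType.Exports.

Local Open Scope classical_set_scope.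
Local Open Scope ring_scope.

(** * Partitions, column by column *)

Lemma geq_trans : transitive geq.
Proof. by move=> a b c /= ba ac; exact: leq_trans ac ba. Qed.

(** The sum of the first [k] column lengths; at a prime [l], the [l ^ k]-torsion of the group of
    type [la] has order [l ^ colsum la k]. *)
Definition colsum (la : seq nat) (k : nat) : nat := sumn (map (minn k) la).

(* At a prime [x = l] this is the number of injective morphisms from the group of
   type [mu] to the group of type [la]. *)
Definition injcount (A : comNzRingType) (x : A) (la mu : seq nat) : A :=
  \prod_(j < size mu)
    (x ^+ colsum la (nth 0%N mu j) - x ^+ (j + colsum la (nth 0%N mu j).-1)).

Lemma injcount_rcons (A : comNzRingType) (x : A) la mu k :
  injcount x la (rcons mu k)
  = injcount x la mu * (x ^+ colsum la k - x ^+ (size mu + colsum la k.-1)).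
Proof.
rewrite /injcount size_rcons big_ord_recr /= nth_rcons ltnn eqxx; congr (_ * _).
by apply: eq_bigr => j _; rewrite nth_rcons ltn_ord.
Qed.

Lemma rmorph_injcount (A B : comNzRingType) (f : {rmorphism A -> B}) x la mu :
  f (injcount x la mu) = injcount (f x) la mu.
Proof. by rewrite rmorph_prod; apply: eq_bigr => j _; rewrite rmorphB !rmorphXn. Qed.

(** Here [mu] grows at its smallest end, which is the head of [rev mu]. The values are taken in
    [int] to have true subtraction. *)
Lemma nindep_injcount l la mu : prime l -> all (leq 1) la ->
  all (leq 1) mu -> sorted geq mu ->
  (nindep (abgrp l la) l (rev mu))%:R = injcount (l%:R : int) la mu.
Proof.
move=> l_prime la_gt0; elim/last_ind: mu => [|mu k IHmu].
  move=> _ _; rewrite /injcount big_ord0 /nindep (_ : #|_| = 1%N) //.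
  apply/eqP/cards1P; exists [tuple]; apply/setP => y; rewrite !inE tuple0.
  by rewrite eqxx.
rewrite all_rcons => /andP[k_gt0 mu_gt0] mu_sorted.
have [mus lek] : sorted geq mu /\ all (leq k) (rev mu).
  move: mu_sorted; rewrite !(sorted_pairwise geq_trans) pairwise_rcons => /andP[h ->].
  by split=> //; rewrite all_rev.
rewrite injcount_rcons -(IHmu mu_gt0 mus) rev_rcons.
have rmu_gt0 : all (leq 1) (rev mu) by rewrite all_rev.
have := nindep_cons l_prime (abgrp_abelian l la) rmu_gt0 k_gt0 lek.
rewrite !card_Ldiv_abgrp // size_rev -expnD => /(congr1 (fun n => n%:R : int)).
by rewrite natrD !natrM !natrX mulrBr => <-; rewrite addrK.
Qed.

Lemma intpart_gt0 (la : intpart) : all (leq 1) la.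
Proof.
case: la => s /= /andP[_ s0]; apply/allP => x xs; rewrite lt0n.
by apply: contraNneq s0 => <-.
Qed.

Lemma intpart_sorted (la : intpart) : sorted geq la.
Proof. by case: la => s /= /andP[]. Qed.

(** Both injection counts are a number of subgroups times the same number of bases, and for
    [la = mu] the number of subgroups is 1. *)
Lemma nsubgroups_injcount l (la mu : intpart) : prime l ->
  (nsubgroups l la mu)%:R * injcount (l%:R : int) mu mu = injcount l%:R la mu.
Proof.
move=> l_prime.
rewrite -!nindep_injcount ?intpart_gt0 ?intpart_sorted //.
rewrite !nindep_nsub ?intpart_gt0 ?abgrp_abelian // nsub_self mul1n.
by rewrite -natrM.
Qed.

Lemma npartsE (la : intpart) : nparts la = size la.
Proof. by apply/eqP; rewrite -all_count intpart_gt0. Qed.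

Lemma intpart_inj : injective parts.
Proof. exact: val_inj. Qed.

(** * Adding and removing the first column *)

Lemma addcol_subproof (k : nat) (nu : intpart) :
  sorted geq (map S nu ++ nseq (k - size nu) 1%N)
  && (0%N \notin map S nu ++ nseq (k - size nu) 1%N).
Proof.
apply/andP; split; last first.
  rewrite mem_cat negb_or mem_nseq /= andbF andbT.
  by apply/negP => /mapP[].
rewrite (sorted_pairwise geq_trans) pairwise_cat; apply/and3P; split.
- apply/allrelP => x y /mapP[z _ ->]; rewrite mem_nseq => /andP[_ /eqP ->].
  by rewrite /= ltnS.
- by rewrite -(sorted_pairwise geq_trans) sorted_map; exact: intpart_sorted.
- by elim: (_ - _)%N => //= n ->; rewrite andbT; elim: n => //= n ->.
Qed.

(* For [size nu <= k]: the diagram of [nu] with a new first column of length [k]. *)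
Definition addcol (k : nat) (nu : intpart) : intpart := IntPart (addcol_subproof k nu).

Lemma delcol_subproof (la : intpart) :
  sorted geq [seq n.-1 | n <- la & (1 < n)%N]
  && (0%N \notin [seq n.-1 | n <- la & (1 < n)%N]).
Proof.
apply/andP; split; last first.
  by apply/negP => /mapP[x]; rewrite mem_filter => /andP[]; lia.
rewrite sorted_map; apply: (@sub_sorted _ geq); first by move=> a b /=; lia.
exact: (sorted_filter geq_trans) (intpart_sorted la).
Qed.

Definition delcol (la : intpart) : intpart := IntPart (delcol_subproof la).

Lemma size_delcol (la : intpart) : (size (delcol la) <= size la)%N.
Proof. by rewrite /= size_map size_filter count_size. Qed.

Lemma delcolK (la : intpart) : addcol (size la) (delcol la) = la.
Proof.
apply: intpart_inj => /=; case: la => s /= /andP[].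
rewrite (sorted_pairwise geq_trans); elim: s => //= x s IHs /andP[xs ps].
rewrite inE negb_or => /andP[x0 s0]; case: ltnP => [x1|x1] /=.
  by rewrite subSS IHs //; congr (_ :: _); lia.
have {x0 x1} x1 : x = 1%N by lia.
(* After a part equal to 1 all later parts are 1 as well, so removing the column leaves nothing of
   them. *)
have f0 : [seq n <- s | (1 < n)%N] = [::].
  apply/eqP; rewrite -[_ == _]negbK -has_filter; apply/hasPn => n /(allP xs) /=.
  by rewrite x1; lia.
by have := IHs ps s0; rewrite f0 /= subn0 x1 => ->.
Qed.

Definition part0 : intpart := @IntPart [::] isT.

Section Addcol.
Variables (k : nat) (nu : intpart).
Hypothesis le_nu : (size nu <= k)%N.

Lemma size_addcol : size (addcol k nu) = k.
Proof. by rewrite /= size_cat size_map size_nseq subnKC. Qed.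

Lemma weight_addcol : weight (addcol k nu) = (k + weight nu)%N.
Proof.
rewrite /weight /= sumn_cat sumn_nseq mul1n.
have -> : sumn (map S nu) = (size nu + sumn nu)%N.
  by elim: (parts nu) => //= a s ->; lia.
by lia.
Qed.

Lemma colsum_addcol i : colsum (addcol k nu) i.+1 = (k + colsum nu i)%N.
Proof.
rewrite /colsum /= map_cat sumn_cat map_nseq sumn_nseq (_ : minn i.+1 1 = 1)%N; last by lia.
rewrite mul1n -map_comp.
have -> : sumn (map (minn i.+1 \o S) nu) = (size nu + sumn (map (minn i) nu))%N.
  by elim: (parts nu) => //= a s ->; lia.
by lia.
Qed.

Lemma delcol_addcol : delcol (addcol k nu) = nu.
Proof.
apply: intpart_inj => /=; rewrite filter_cat map_cat.
rewrite (_ : [seq n <- nseq _ _ | _] = [::]); last by elim: (_ - _)%N.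
rewrite cats0 filter_map -map_comp.
rewrite (_ : seq.filter _ _ = parts nu); first exact: map_id.
by apply/all_filterP; exact: intpart_gt0.
Qed.

Lemma column_addcol i : (0 < i)%N -> column (addcol k nu) i.+1 = column nu i.
Proof.
move=> i_gt0; rewrite /column /= count_cat count_map count_nseq /=.
by rewrite (_ : (i < 1)%N = false) ?addn0 //; lia.
Qed.

Lemma partmult_addcol i : (0 < i)%N -> partmult (addcol k nu) i.+1 = partmult nu i.
Proof.
move=> i_gt0; rewrite /partmult /= count_cat count_map count_nseq /=.
by rewrite (_ : (1 == i.+1)%N = false) ?addn0 //; lia.
Qed.

Lemma partmult1_addcol : partmult (addcol k nu) 1 = (k - size nu)%N.
Proof.
rewrite /partmult /= count_cat count_map count_nseq /= mul1n.
rewrite (_ : count _ _ = 0%N) //; apply/eqP; rewrite -leqn0 leqNgt -has_count.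
by apply/hasPn => x /(allP (intpart_gt0 nu)) /=; lia.
Qed.

(** Equality fails only when an empty column is added to the empty partition. *)
Lemma largest_addcol : (largest (addcol k nu) <= (largest nu).+1)%N.
Proof. by rewrite /largest /=; case: (parts nu) => //=; case: (_ - _)%N. Qed.

(** The boolean [j < k] is coerced to a number: 1 on the padded parts, and the default 0 past the
    end. *)
Lemma nth_addcol j : nth 0%N (addcol k nu) j =
  if (j < size nu)%N then (nth 0%N nu j).+1 else (j < k)%N.
Proof.
rewrite /= nth_cat size_map nth_nseq; case: ltnP => jn; first by rewrite (nth_map 0%N).
by rewrite (_ : (j - _ < _)%N = (j < k)%N); [case: (j < k)%N | lia].
Qed.

End Addcol.

Lemma largest_delcol la L : (largest (delcol la) <= L)%N = (largest la <= L.+1)%N.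
Proof.
rewrite /largest /=; move: (intpart_sorted la) (intpart_gt0 la).
case: (parts la) => //= a s pas /andP[a1 _]; case: ltnP => a2 /=; first by lia.
rewrite (_ : [seq n <- s | (1 < n)%N] = [::]) /=; first by lia.
apply/eqP; rewrite -[_ == _]negbK -has_filter; apply/hasPn => n ns.
by have /= := allP (order_path_min geq_trans pas) _ ns; lia.
Qed.

Lemma largest0 la : (largest la <= 0)%N -> la = part0.
Proof.
move=> l0; apply: intpart_inj => /=; move: l0 (intpart_gt0 la); rewrite /largest.
by case: (parts la) => //= a s; case: a.
Qed.

(** The recursion is on the first column, bounded by [c], which then bounds the next one; sums over
    this list thus unfold one column at a time. *)
Fixpoint parts_le (L c : nat) : seq intpart :=
  if L is L'.+1 then [seq addcol k nu | k <- iota 0 c.+1, nu <- parts_le L' k]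
  else [:: part0].

Lemma mem_parts_le L c (la : intpart) :
  (la \in parts_le L c) = (largest la <= L)%N && (size la <= c)%N.
Proof.
elim: L c la => [|L IHL] c la.
  rewrite inE; apply/eqP/andP => [->|[/largest0 -> _]] //=.
apply/allpairsPdep/andP => [[k [nu [kc]]]|[laL lac]].
  rewrite IHL mem_iota in kc * => /andP[nuL nuk] ->.
  by rewrite size_addcol //; split; [exact: leq_trans (largest_addcol _ _) _ | lia].
exists (size la), (delcol la); rewrite delcolK mem_iota IHL largest_delcol laL.
by rewrite size_delcol; split => //; lia.
Qed.

Lemma parts_le_uniq L c : uniq (parts_le L c).
Proof.
elim: L c => // L IHL c.
apply: (@allpairs_uniq_dep nat (fun=> intpart) _ addcol (iota 0 c.+1) (parts_le L)).
- exact: iota_uniq.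
- by move=> k _; exact: IHL.
move=> _ _ /allpairsPdep[k1 [n1 [_ h1 ->]]] /allpairsPdep[k2 [n2 [_ h2 ->]]] /= e.
move: h1 h2; rewrite !mem_parts_le => /andP[_ s1] /andP[_ s2].
have ek : k1 = k2 by rewrite -(size_addcol s1) -(size_addcol s2) e.
by subst k2; congr Tagged; rewrite -(delcol_addcol k1 n1) e delcol_addcol.
Qed.

Lemma sum_parts_leS (V : nmodType) L c (F : intpart -> V) :
  \sum_(la <- parts_le L.+1 c) F la
  = \sum_(k < c.+1) \sum_(nu <- parts_le L k) F (addcol k nu).
Proof.
transitivity (\sum_(la <- [seq addcol k nu | k <- iota 0 c.+1, nu <- parts_le L k]) F la).
  by [].
rewrite big_allpairs_dep.
by rewrite -(big_mkord xpredT (fun k => \sum_(nu <- parts_le L k) F (addcol k nu)))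
   /index_iota subn0.
Qed.

Lemma colsum0 la : colsum la 0 = 0%N.
Proof. by rewrite /colsum; elim: la => //= a s ->; rewrite min0n. Qed.

(** The parts of [addcol b ka] above 1 come from [ka], and each gains a factor [x ^+ k], as the new
    column raises both exponents by [k]. The parts equal to 1 have the indices [size ka <= j < b]
    and give [x ^+ k - x ^+ j]. *)
Lemma injcount_addcol (A : comNzRingType) (x : A) k (nu : intpart) b (ka : intpart) :
  (size nu <= k)%N -> (size ka <= b)%N ->
  injcount x (addcol k nu) (addcol b ka) =
  x ^+ (k * size ka) * injcount x nu ka * \prod_(size ka <= j < b) (x ^+ k - x ^+ j).
Proof.
move=> nuk kab; rewrite /injcount size_addcol //.
rewrite -(big_mkord xpredT (fun j => x ^+ colsum (addcol k nu) (nth 0%N (addcol b ka) j)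
  - x ^+ (j + colsum (addcol k nu) (nth 0%N (addcol b ka) j).-1))).
rewrite (big_cat_nat (n := size ka)) //; congr (_ * _); last first.
  apply: eq_big_nat => j /andP[kj jb]; rewrite nth_addcol // jb ltnNge kj /=.
  by rewrite colsum_addcol // !colsum0 !addn0.
have -> : x ^+ (k * size ka) = \prod_(j < size ka) x ^+ k.
  by rewrite prodr_const card_ord exprM.
rewrite big_mkord -big_split /=.
apply: eq_bigr => j _; rewrite nth_addcol // ltn_ord /= colsum_addcol //.
have /= := allP (intpart_gt0 ka) _ (mem_nth 0%N (ltn_ord j)).
case: (nth _ _ _) => // m _; rewrite colsum_addcol // mulrBr -!exprD.
by congr (_ - _ ^+ _); rewrite addnCA.
Qed.

Lemma addcol_ind (P : intpart -> Prop) : P part0 ->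
  (forall k (nu : intpart), (size nu <= k)%N -> P nu -> P (addcol k nu)) -> forall la, P la.
Proof.
move=> P0 PS la.
suff h L : forall ka, (largest ka <= L)%N -> P ka by exact: (h (largest la)).
elim: L => [|L IHL] {}la laL.
  by rewrite (largest0 laL).
rewrite -(delcolK la); apply: PS; first exact: size_delcol.
by apply: IHL; rewrite largest_delcol.
Qed.

Lemma injcount_monic (mu : intpart) : injcount ('X : {poly int}) mu mu \is monic.
Proof.
elim/addcol_ind: mu => [|k nu nuk IH]; first by rewrite /injcount big_ord0 monic1.
rewrite injcount_addcol // !rpredM //; first by rewrite monicXn.
rewrite big_nat; apply: rpred_prod => j /andP[_ jk].
by rewrite monicE lead_coefDl ?lead_coefXn // size_polyN !size_polyXn ltnS.
Qed.

(** * The automorphism factor at real p > 1 *)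

Section Aut.
Variables (R : realType) (p : R).
Hypothesis p_gt1 : 1 < p.

Let p_gt0 : 0 < p. Proof. exact: lt_trans ltr01 p_gt1. Qed.
Let p_neq0 : p != 0. Proof. by rewrite gt_eqF. Qed.

(** Beyond the largest part, columns and multiplicities vanish. The free bound [M] is needed because
    [largest_addcol] is only an inequality. *)
Lemma autcardE M (la : intpart) : (largest la <= M)%N ->
  autcard p la = p ^+ (\sum_(1 <= i < M.+1) column la i ^ 2)
  * \prod_(1 <= i < M.+1) poch p p^-1 (partmult la i).
Proof.
move=> laM; rewrite /autcard.
have big i : (largest la < i)%N -> column la i = 0%N /\ partmult la i = 0%N.
  rewrite /largest /column /partmult => lai.
  have h x : x \in parts la -> (x < i)%N.
    move: (intpart_sorted la) lai.
    case: (parts la) => //= a s /(order_path_min geq_trans) sa ai.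
    by rewrite inE => /predU1P[->|/(allP sa) /=] //; lia.
  split; apply/eqP; rewrite -leqn0 leqNgt -has_count; apply/hasPn => x /h /=; lia.
have s0 : (\sum_((largest la).+1 <= i < M.+1) column la i ^ 2 = 0)%N.
  by rewrite big_nat big1 // => i /andP[/big[-> _]].
have p0 : \prod_((largest la).+1 <= i < M.+1) poch p p^-1 (partmult la i) = 1.
  by rewrite big_nat big1 // => i /andP[/big[_ ->] _]; rewrite /poch big_ord0.
rewrite (big_cat_nat (n := (largest la).+1) (p := M.+1)) // s0 /= addn0.
by rewrite [X in _ = _ * X](big_cat_nat (n := (largest la).+1)) //= p0 mulr1.
Qed.

Lemma autcard_addcol k (nu : intpart) : (size nu <= k)%N ->
  autcard p (addcol k nu) = p ^+ (k ^ 2) * poch p p^-1 (k - size nu) * autcard p nu.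
Proof.
move=> nuk; rewrite (autcardE (largest_addcol k nu)) /autcard.
rewrite [in LHS]big_ltn // [X in _ * X = _]big_ltn // !big_add1 /=.
rewrite -/(nparts _) npartsE size_addcol // partmult1_addcol // exprD.
rewrite mulrACA -!mulrA; congr (_ * (_ * (_ ^+ _ * _))).
  by apply: eq_bigr => i _; rewrite column_addcol.
by apply: eq_bigr => i _; rewrite partmult_addcol.
Qed.

Lemma pochS n : poch p p^-1 n.+1 = poch p p^-1 n * (1 - p ^- n.+1).
Proof. by rewrite /poch big_ord_recr /= -invfM -exprS. Qed.

Lemma pow_inv_lt1 n : p ^- n.+1 < 1.
Proof. by rewrite invf_lt1 ?exprn_gt0 // exprn_egt1. Qed.

Lemma poch_gt0 n : 0 < poch p p^-1 n.
Proof.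
elim: n => [|n IHn]; first by rewrite /poch big_ord0.
by rewrite pochS mulr_gt0 // subr_gt0 pow_inv_lt1.
Qed.

(** Pulling [p ^+ k] out of each factor leaves [1 - p ^- (k - j)], and these telescope to a ratio of
    two [poch] values. *)
Lemma prod_pow_sub b2 b k : (b2 <= b)%N -> (b <= k)%N ->
  \prod_(b2 <= j < b) (p ^+ k - p ^+ j) * poch p p^-1 (k - b)
  = p ^+ (k * (b - b2)) * poch p p^-1 (k - b2).
Proof.
elim: b => [|b IHb] b2b bk.
  by rewrite big_geq // sub0n muln0 mul1r expr0 mul1r (_ : b2 = 0)%N //; lia.
move: b2b; rewrite leq_eqVlt => /predU1P[->|b2b].
  by rewrite big_geq // subnn muln0 expr0.
rewrite big_nat_recr //= subSn // mulnS exprD.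
have e : poch p p^-1 (k - b) = poch p p^-1 (k - b.+1) * (1 - p ^+ b / p ^+ k).
  rewrite (_ : k - b = (k - b.+1).+1)%N; last by lia.
  rewrite pochS (_ : p ^+ k = p ^+ b * p ^+ (k - b.+1).+1); last first.
    by rewrite -exprD; congr (_ ^+ _); lia.
  by congr (_ * (1 - _)); rewrite invfM mulVKf ?expf_neq0.
rewrite -[RHS]mulrA -IHb ?(ltnW bk) // e.
by field; rewrite expf_neq0.
Qed.

(** At a prime this says that injective endomorphisms are automorphisms; for real [p] both sides
    obey the same recursion under [addcol]. *)
Lemma injcount_autcard (mu : intpart) : injcount p mu mu = autcard p mu.
Proof.
elim/addcol_ind: mu => [|k nu nuk IH].
  by rewrite /injcount big_ord0 /autcard /= !big_geq // mulr1.
rewrite injcount_addcol // autcard_addcol // IH.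
have := prod_pow_sub nuk (leqnn k); rewrite subnn [poch _ _ 0]big_ord0 mulr1 => ->.
rewrite mulrAC; congr (_ * _); rewrite mulrA -exprD -mulnDr subnKC //.
Qed.

Lemma autcard_gt0 (mu : intpart) : 0 < autcard p mu.
Proof.
elim/addcol_ind: mu => [|k nu nuk IH]; first by rewrite /autcard !big_geq // mulr1 ltr01.
rewrite autcard_addcol //; apply: mulr_gt0 => //; apply: mulr_gt0; last exact: poch_gt0.
exact: exprn_gt0.
Qed.

(** The two claims are proved together: when [k < b], either the inner count vanishes by induction
    or the factor at [j = k] is zero; when [b <= k], all factors are nonnegative. *)
Lemma injcount_ge0_eq0 (mu la : intpart) : 0 <= injcount p la mu /\
  ((size la < size mu)%N -> injcount p la mu = 0).
Proof.
elim/addcol_ind: mu la => [|b ka kab IH] la.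
  by rewrite /injcount big_ord0 ler01.
rewrite -(delcolK la); move: (size la) (delcol la) (size_delcol la) => k nu nuk.
have [IH1 IH2] := IH nu; rewrite injcount_addcol // !size_addcol //.
have h0 : (k < b)%N ->
    p ^+ (k * size ka) * injcount p nu ka * \prod_(size ka <= j < b) (p ^+ k - p ^+ j) = 0.
  move=> kb; case: (ltnP k (size ka)) => kka.
    by rewrite IH2 ?mulr0 ?mul0r //; apply: leq_ltn_trans kka.
  rewrite (big_cat_nat (n := k)) ?(ltnW kb) //= (big_ltn kb) subrr mul0r.
  by rewrite !mulr0.
split=> //; case: (ltnP k b) => kb; first by rewrite h0.
rewrite !mulr_ge0 ?exprn_ge0 ?(ltW p_gt0) // big_nat prodr_ge0 // => j /andP[_ jb].
by rewrite subr_ge0 ler_weXn2l ?(ltW p_gt1) //; lia.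
Qed.

End Aut.

(** * The subgroup polynomial *)

Lemma horner_norm_le (A : realDomainType) (f : {poly A}) m : (size f <= m.+1)%N ->
  exists C : A, forall x, 1 <= x -> `|f.[x]| <= C * x ^+ m.
Proof.
move=> sf; exists (\sum_(i < m.+1) `|f`_i|) => x x1.
rewrite (horner_coef_wide _ sf) mulr_suml (le_trans (ler_norm_sum _ _ _)) //.
apply: ler_sum => i _; rewrite normrM ler_wpM2l // normrX ger0_norm ?(le_trans ler01) //.
by rewrite ler_weXn2l // -ltnS.
Qed.

(** At large primes [d] exceeds [r] in absolute value, so divisibility forces [r] to vanish there,
    which gives too many roots. *)
Lemma poly_int_divisible_eq0 (r d : {poly int}) : d \is monic ->
  (size r < size d)%N ->
  (forall l : nat, prime l -> exists n : int, r.[l%:R] = n * d.[l%:R]) -> r = 0.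
Proof.
move=> dm; have: size d = (size d).-1.+1 by rewrite prednK // lt0n size_poly_eq0 monic_neq0.
case: (size d).-1 => [|m] sd; rewrite sd => sr rd.
  by apply/eqP; rewrite -size_poly_eq0 -leqn0.
have [C hC] : exists C : int, forall x : int, 1 <= x -> `|r.[x]| <= C * x ^+ m.
  exact: horner_norm_le.
have [C' hC'] : exists C : int, forall x : int, 1 <= x ->
    `|(d - 'X^(m.+1)).[x]| <= C * x ^+ m.
  apply: horner_norm_le.
  apply/leq_sizeP => j; rewrite leq_eqVlt coefB coefXn => /predU1P[<-|mj].
    by move: (monicP dm); rewrite lead_coefE sd /= eqxx => ->; rewrite subrr.
  by rewrite nth_default ?sd // gtn_eqF // subrr.
(* Above this threshold [|d(l)| >= l^(m+1) - C' l^m > C l^m >= |r(l)|], so the integer cofactor is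
   0. *)
have rl0 l : prime l -> C + C' < l%:R -> r.[l%:R] = 0.
  move=> pl Cl; have [n e] := rd l pl.
  have l1 : (1 : int) <= l%:R by rewrite ler1n prime_gt0.
  have lm : (0 : int) < l%:R ^+ m by rewrite exprn_gt0 // (lt_le_trans ltr01 l1).
  have := hC _ l1; have := hC' _ l1; rewrite e hornerD hornerN hornerXn normrM => h' h.
  have dl : C * l%:R ^+ m < `|d.[l%:R]|.
    apply: (@lt_le_trans _ _ (l%:R ^+ m.+1 - C' * l%:R ^+ m)).
      by rewrite exprS -mulrBl ltr_pM2r // ltrBrDr.
    have := lerB_dist (l%:R ^+ m.+1) d.[l%:R]; rewrite distrC.
    by have := ler_norm ((l%:R : int) ^+ m.+1); lra.
  have n0 : `|n| < 1.
    rewrite ltNge; apply/negP => n1; move: (lt_le_trans dl (ler_peMl (normr_ge0 _) n1)).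
    by rewrite ltNge h.
  by rewrite (_ : n = 0) ?mul0r //; lia.
apply/eqP; apply/negPn/negP => nz.
have [s [us ps ss]] : exists s : seq nat,
    [/\ uniq s, all (fun l => prime l && (C + C' < l%:R :> int)) s & size s = size r].
  elim: (size r) => [|n [s [us ps ss]]]; first by exists [::].
  have [q ltq pq] := prime_above (maxn (absz (C + C')) (\max_(i <- s) i)).
  move: ltq; rewrite gtn_max => /andP[q1 q2].
  exists (q :: s); rewrite /= us ps pq ss !andbT; split=> //; last by lia.
  apply/negP => qs; move: q2; rewrite ltnNge => /negP; apply.
  exact: (@leq_bigmax_seq _ s xpredT id).
suff : (size [seq l%:R : int | l <- s] < size r)%N by rewrite size_map ss ltnn.
apply: max_poly_roots => //; last first.
  by rewrite map_inj_uniq //; apply: mulrIn; rewrite oner_eq0.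
by apply/allP => _ /mapP[l /(allP ps) /andP[pl Cl] ->]; rewrite /root rl0.
Qed.

Lemma injcount_dvd (la mu : intpart) :
  exists Q : {poly int}, injcount 'X la mu = Q * injcount 'X mu mu.
Proof.
have dm := injcount_monic mu.
set N := injcount _ la mu; set D := injcount _ mu mu in dm *.
have e := Pdiv.RingMonic.rdivp_eq dm N.
exists (Pdiv.Ring.rdivp N D); rewrite [LHS]e.
rewrite [X in _ + X](poly_int_divisible_eq0 dm) ?addr0 //.
  by rewrite Pdiv.Ring.ltn_rmodpN0 // monic_neq0.
(* At [l] the dividend is [nsubgroups l la mu] times the divisor; subtracting the quotient's share
   leaves the remainder. *)
move=> l pl; exists ((nsubgroups l la mu)%:R - (Pdiv.Ring.rdivp N D).[l%:R]).
have hX (ka : seq nat) : (injcount 'X ka mu).[l%:R] = injcount (l%:R : int) ka mu.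
  by rewrite -[LHS]/(horner_eval l%:R _) rmorph_injcount /= /horner_eval hornerX.
have eN : N.[l%:R] = (Pdiv.Ring.rdivp N D).[l%:R] * D.[l%:R]
    + (Pdiv.Ring.rmodp N D).[l%:R] by rewrite {1}e hornerD hornerM.
have eD : (nsubgroups l la mu)%:R * D.[l%:R] = N.[l%:R].
  by rewrite /D /N !hX nsubgroups_injcount.
by rewrite mulrBl eD eN addrAC subrr add0r.
Qed.

Lemma surcardE (R : realType) (p : R) (la mu : intpart) : 1 < p ->
  surcard p la mu = injcount p la mu.
Proof.
move=> p_gt1; have [Q e] := injcount_dvd la mu.
have hQ (x : R) : injcount x la mu = (map_poly intr Q).[x] * injcount x mu mu.
  have := congr1 (fun f : {poly int} => (map_poly intr f).[x]) e.
  have mX (ka : seq nat) :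
      (map_poly (intr : int -> R) (injcount 'X ka mu)).[x] = injcount x ka mu.
    by rewrite rmorph_injcount /= map_polyX -[LHS]/(horner_eval x _)
       rmorph_injcount /= /horner_eval hornerX.
  by rewrite rmorphM hornerM /= !mX.
have isQ : is_subgroup_poly la mu (map_poly intr Q : {poly R}).
  move=> l pl; have := nsubgroups_injcount la mu pl.
  have hE (ka : seq nat) : (injcount (l%:R : int) ka mu)%:~R = injcount (l%:R : R) ka mu.
    by rewrite rmorph_injcount /= rmorph_nat.
  move/(congr1 (fun z : int => z%:~R : R)); rewrite rmorphM /= rmorph_nat !hE hQ.
  move/mulIf => -> //; rewrite (injcount_autcard (p := l%:R)) ?gt_eqF ?autcard_gt0 //;
    by rewrite ltr1n prime_gt1.
rewrite /surcard (_ : subgroup_poly R la mu = map_poly intr Q).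
  by rewrite -injcount_autcard // -hQ.
(* The image of [Q] witnesses existence, so [xget] does not return its junk value. *)
apply: (is_subgroup_poly_unique _ isQ); rewrite /subgroup_poly.
by case: xgetP => [f _ //|/(_ _ isQ)].
Qed.

(** * Summation over one column length *)

Section GaussianBinomial.
Variables (A : comNzRingType) (q : A).

(** Gaussian binomials by their Pascal rule, hence without division. The truncated exponent is
    harmless: for [n' < m'] it multiplies 0. *)
Fixpoint gbin (n m : nat) : A :=
  match n, m with
  | _, 0%N => 1
  | 0%N, _.+1 => 0
  | n'.+1, m'.+1 => gbin n' m'.+1 + q ^+ (n' - m') * gbin n' m'
  end.

Lemma gbin0 n : gbin n 0 = 1. Proof. by case: n. Qed.

Lemma gbinS n m : gbin n.+1 m.+1 = gbin n m.+1 + q ^+ (n - m) * gbin n m.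
Proof. by []. Qed.

Lemma gbin_small n m : (n < m)%N -> gbin n m = 0.
Proof.
elim: n m => [|n IHn] [|m] //= nm.
by rewrite !IHn ?mulr0 ?addr0 //; lia.
Qed.

Lemma gbin_prod n m :
  gbin (n + m) m * \prod_(i < m) (1 - q ^+ i.+1) * \prod_(i < n) (1 - q ^+ i.+1)
  = \prod_(i < n + m) (1 - q ^+ i.+1).
Proof.
elim: m n => [|m IHm] n; first by rewrite addn0 gbin0 big_ord0 !mul1r.
elim: n => [|n IHn].
  have := IHm 0%N; rewrite !big_ord0 !add0n /=.
  rewrite (@gbin_small m m.+1) // subnn add0r mul1r !mulr1.
  by move=> e; rewrite big_ord_recr /= mulrA e.
move: IHn (IHm n.+1); rewrite addSn !addnS => IHn IHm'.
have -> : gbin (n + m).+2 m.+1 = gbin (n + m).+1 m.+1 + q ^+ n.+1 * gbin (n + m).+1 m.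
  by rewrite [LHS]/=; congr (_ + _ ^+ _ * _); lia.
(* With [P] the product of length [n + m + 1], the Pascal terms become [(1 - q^(n+1)) P] and
   [q^(n+1) (1 - q^(m+1)) P], which add up to [(1 - q^(n+m+2)) P]. *)
rewrite mulrDl mulrDl.
rewrite [X in X + _](_ : _ = (1 - q ^+ n.+1) *
  \prod_(i < (n + m).+1) (1 - q ^+ i.+1)).
  rewrite [X in _ + X](_ : _ = q ^+ n.+1 * (1 - q ^+ m.+1) *
    \prod_(i < (n + m).+1) (1 - q ^+ i.+1)).
    rewrite -mulrDl [RHS]big_ord_recr /= mulrC; congr (_ * _).
    by rewrite (_ : (n + m).+2 = n.+1 + m.+1)%N ?exprD; [ring | lia].
  by rewrite -IHm' [\prod_(i < m.+1) _]big_ord_recr /=; ring.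
by rewrite -IHn [\prod_(i < n.+1) _]big_ord_recr /=; ring.
Qed.

(* The two halves of Pascal's rule split the sum as
   [T n.+1 v = (1 - v q^(n+1)) T n v + v q^(n+1) T n (v q)]. *)
Lemma gbin_sum_eq1 n v :
  \sum_(m < n.+1) gbin n m * v ^+ m * q ^+ (m ^ 2)
    * \prod_(m.+1 <= i < n.+1) (1 - v * q ^+ i) = 1.
Proof.
elim: n v => [|n IHn] v; first by rewrite big_ord_recl big_ord0 big_geq //= !mulr1 addr0.
pose F n' m := gbin n' m * v ^+ m * q ^+ (m ^ 2) * \prod_(m.+1 <= i < n.+2) (1 - v * q ^+ i).
rewrite -(big_mkord xpredT (F n.+1)) big_ltn // big_add1 big_mkord /F.
under [X in _ + X]eq_bigr => m _ do rewrite gbinS !mulrDl.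
rewrite big_split /= expr0 !mulr1 mul1r addrA.
(* The isolated product is the term [m = 0] of the first half; the term [m = n + 1] vanishes, and
   the factor at [i = n + 1] is common to the rest. *)
have -> : \prod_(1 <= i < n.+2) (1 - v * q ^+ i)
    + \sum_(m < n.+1) gbin n m.+1 * v ^+ m.+1 * q ^+ (m.+1 ^ 2)
      * \prod_(m.+2 <= i < n.+2) (1 - v * q ^+ i) = 1 - v * q ^+ n.+1.
  transitivity (\sum_(m < n.+2) gbin n m * v ^+ m * q ^+ (m ^ 2)
      * \prod_(m.+1 <= i < n.+2) (1 - v * q ^+ i)).
    rewrite -[RHS](big_mkord xpredT (F n)) [RHS]big_ltn //.
    rewrite [X in _ = _ + X]big_add1 big_mkord /F.
    by rewrite gbin0 expr0 !mul1r.
  rewrite big_ord_recr /= gbin_small // !mul0r addr0.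
  rewrite -[RHS]mul1r -[X in _ = X * _](IHn v) mulr_suml; apply: eq_bigr => m _.
  by rewrite big_nat_recr /= ?mulrA //; have := ltn_ord m; lia.
rewrite -[RHS](subrK (v * q ^+ n.+1)); congr (_ + _).
rewrite -[RHS]mulr1 -[X in _ = _ * X](IHn (v * q)) mulr_sumr; apply: eq_bigr => m _.
rewrite big_add1 /= !mulrA.
under eq_bigr => i _ do rewrite exprS mulrA.
congr (_ * _); rewrite exprMn.
have -> : v * q ^+ n.+1 * gbin n m * (v ^+ m * q ^+ m) * q ^+ (m ^ 2)
  = gbin n m * v ^+ m.+1 * q ^+ (n.+1 + m + m ^ 2).
  by rewrite (exprD q _ (m ^ 2)) (exprD q n.+1) (exprS v); ring.
have -> : (n.+1 + m + m ^ 2 = (n - m) + m.+1 ^ 2)%N.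
  by have := ltn_ord m; rewrite !expnS !expn0; lia.
by rewrite exprD; ring.
Qed.

End GaussianBinomial.

Section Kernel.
Variables (R : realType) (p u : R).
Hypotheses (p_gt1 : 1 < p) (u_gt0 : 0 < u) (u_ltp : u < p).

Let p_gt0 : 0 < p. Proof. exact: lt_trans ltr01 p_gt1. Qed.
Let p_neq0 : p != 0. Proof. by rewrite gt_eqF. Qed.

Local Notation pp := (poch p p^-1).

Let pp_neq0 n : pp n != 0. Proof. by rewrite gt_eqF ?poch_gt0. Qed.

Definition upoch (n : nat) : R := \prod_(1 <= i < n.+1) (1 - u / p ^+ i).

Lemma upoch_cat m n : (m <= n)%N ->
  upoch n = upoch m * \prod_(m.+1 <= i < n.+1) (1 - u / p ^+ i).
Proof. by move=> mn; rewrite /upoch (big_cat_nat (n := m.+1)). Qed.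

Lemma upoch_factor i : (0 < i)%N -> 0 < 1 - u / p ^+ i <= 1.
Proof.
move=> i0; have pi : 0 < p ^+ i by rewrite exprn_gt0.
apply/andP; split; last by rewrite gerBl divr_ge0 // ltW.
rewrite subr_gt0 ltr_pdivrMr // mul1r (lt_le_trans u_ltp) //.
by rewrite -[leLHS]expr1 ler_weXn2l ?(ltW p_gt1).
Qed.

Lemma upoch_gt0 n : 0 < upoch n.
Proof. by rewrite /upoch big_nat; apply: prodr_gt0 => i /andP[/upoch_factor/andP[]]. Qed.

Let upoch_neq0 n : upoch n != 0. Proof. by rewrite gt_eqF ?upoch_gt0. Qed.

Lemma upoch_le m n : (m <= n)%N -> upoch n <= upoch m.
Proof.
move=> mn; rewrite (upoch_cat mn) ler_piMr ?(ltW (upoch_gt0 _)) //.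
rewrite big_nat; apply: prodr_ile1 => i /andP[mi _].
by have /andP[/ltW -> ->] := upoch_factor (leq_ltn_trans (leq0n m) mi).
Qed.

(** The expected moment for [d = c] and a partition of [w] with [b] parts, divided by the
    normalisation [pp c * upoch c]. *)
Definition moment_value (c b w : nat) : R :=
  if (b <= c)%N then u ^+ w / (pp (c - b) * upoch c) else 0.

(** The unnormalised weight of a column of length [k] following one of length [c], when the current
    and next columns of [mu] have lengths [b] and [b2]. *)
Definition column_kernel (c k b b2 : nat) : R :=
  u ^+ k / p ^+ (k ^ 2) * p ^+ (k * b2) * \prod_(b2 <= j < b) (p ^+ k - p ^+ j) / pp (c - k).

Lemma pp_gbin n m : pp (n + m) = gbin p^-1 (n + m) m * pp m * pp n.
Proof.
have E k : pp k = \prod_(i < k) (1 - p^-1 ^+ i.+1).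
  by apply: eq_bigr => i _; rewrite exprS exprVn.
by rewrite !E gbin_prod.
Qed.

Lemma column_kernel_moment c b b2 w : (b2 <= b)%N ->
  \sum_(k < c.+1) column_kernel c k b b2 * moment_value k b2 w = moment_value c b (b + w).
Proof.
move=> b2b.
have low k : (k < b)%N -> column_kernel c k b b2 * moment_value k b2 w = 0.
  move=> kb; rewrite /moment_value; case: leqP => b2k; last by rewrite mulr0.
  rewrite /column_kernel (big_cat_nat (n := k)) ?(ltnW kb) //= (big_ltn kb) subrr mul0r.
  by rewrite !mulr0 !mul0r.
rewrite -(big_mkord xpredT (fun k => column_kernel c k b b2 * moment_value k b2 w)).
rewrite {2}/moment_value; case: leqP => bc; last first.
  by rewrite big_nat big1 // => k /andP[_ kc]; apply: low; lia.
rewrite (big_cat_nat (n := b)) //=; last by lia.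
rewrite big_nat big1 ?add0r; last by move=> k /andP[_ kb]; apply: low.
rewrite -{1}[b]add0n big_addn subSn // big_mkord.
(* After the shift [k = m + b], the terms are those of the q-identity with [q = 1/p], [n = c - b]
   and [v = u / p^b], times the right-hand side. *)
rewrite -[RHS]mulr1 -(gbin_sum_eq1 p^-1 (c - b) (u / p ^+ b)) mulr_sumr.
apply: eq_bigr => m _; have mc : (m <= c - b)%N by rewrite -ltnS.
rewrite /moment_value /column_kernel (leq_trans b2b (leq_addl _ _)).
have := prod_pow_sub p_gt1 b2b (leq_addl m b); rewrite addnK.
move=> /(canRL (mulfK (pp_neq0 _))) ->.
have cm : (c - (m + b) = c - b - m)%N by lia.
have e1 := pp_gbin (c - b - m) m; rewrite subnK // in e1.
have e2 : upoch c = upoch (m + b) *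
    \prod_(m.+1 <= i < (c - b).+1) (1 - u / p ^+ b * p^-1 ^+ i).
  rewrite (upoch_cat (_ : m + b <= c)%N); last by lia.
  rewrite (_ : (m + b).+1 = m.+1 + b)%N // big_addn subSn //; congr (_ * _).
  by apply: eq_bigr => i _; rewrite exprD exprVn invfM mulrAC mulrA.
have P0 : \prod_(m.+1 <= i < (c - b).+1) (1 - u / p ^+ b * p^-1 ^+ i) != 0.
  by have := upoch_neq0 c; rewrite e2 mulf_eq0 negb_or => /andP[].
have g0 : gbin p^-1 (c - b) m != 0.
  by have := pp_neq0 (c - b); rewrite e1 !mulf_eq0 !negb_or => /andP[/andP[]].
rewrite cm e1 e2.
(* The exponent splits as [(m + b)^2 = (m + b) b + b m + m^2]; the first term cancels against the
   kernel, the second goes into [v^m]. *)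
have -> : p ^+ ((m + b) ^ 2) = p ^+ ((m + b) * b2) * p ^+ ((m + b) * (b - b2))
    * (p ^+ b) ^+ m * p ^+ (m ^ 2).
  by rewrite -exprM -!exprD; congr (_ ^+ _); rewrite -mulnDr subnKC // !expnS !expn0; lia.
have pn n : p ^+ n != 0 by rewrite expf_neq0.
rewrite expr_div_n exprVn !exprD.
by field; rewrite ?pn ?P0 ?g0 ?pp_neq0 ?upoch_neq0 ?expf_neq0.
Qed.

End Kernel.

(** * Truncated moments and their limit *)

Section Bounds.
Variables (R : realType) (p u : R).
Hypotheses (p_gt1 : 1 < p) (u_gt0 : 0 < u) (u_ltp : u < p).

Let p_gt0 : 0 < p. Proof. exact: lt_trans ltr01 p_gt1. Qed.

Local Notation pp := (poch p p^-1).

Let pp_gt0 n : 0 < pp n. Proof. exact: poch_gt0. Qed.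
Let pp_neq0 n : pp n != 0. Proof. by rewrite gt_eqF. Qed.
Let upoch_neq0 n : upoch p u n != 0. Proof. by rewrite gt_eqF ?upoch_gt0. Qed.

(** The summand of the moment without its constant factor, with [d] generalised to the preceding
    column length [c]. *)
Definition column_term (c : nat) (la mu : intpart) : R :=
  u ^+ weight la * injcount p la mu / autcard p la / pp (c - size la).

Lemma column_term_addcol c k (nu : intpart) b (ka : intpart) :
  (size nu <= k)%N -> (size ka <= b)%N ->
  column_term c (addcol k nu) (addcol b ka)
  = column_kernel p u c k b (size ka) * column_term k nu ka.
Proof.
move=> nuk kab; rewrite /column_term /column_kernel weight_addcol // injcount_addcol //.
rewrite autcard_addcol // size_addcol // exprD.
have a0 : autcard p nu != 0 by rewrite gt_eqF ?autcard_gt0.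
have q0 : p ^+ (k ^ 2) != 0 by rewrite gt_eqF ?exprn_gt0.
by field; rewrite ?a0 ?q0 ?pp_neq0.
Qed.

Definition truncated_moment (L c : nat) (mu : intpart) : R :=
  \sum_(la <- parts_le L c) column_term c la mu.

Lemma truncated_momentS L c b (ka : intpart) : (size ka <= b)%N ->
  truncated_moment L.+1 c (addcol b ka)
  = \sum_(k < c.+1) column_kernel p u c k b (size ka) * truncated_moment L k ka.
Proof.
move=> kab; rewrite /truncated_moment sum_parts_leS; apply: eq_bigr => k _.
rewrite mulr_sumr; apply: eq_big_seq => nu; rewrite mem_parts_le => /andP[_ nuk].
exact: column_term_addcol.
Qed.

(** Lets the column recursion continue after [mu] is exhausted, with empty columns. *)
Lemma part0_addcol : part0 = addcol 0 part0.
Proof. exact: intpart_inj. Qed.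

Lemma column_kernel_ge0 c k b b2 : (b2 <= k)%N -> 0 <= column_kernel p u c k b b2.
Proof.
move=> b2k; rewrite /column_kernel divr_ge0 ?(ltW (pp_gt0 _)) // mulr_ge0 //.
  by rewrite mulr_ge0 ?divr_ge0 ?exprn_ge0 // ltW.
case: (leqP b k) => kb.
  rewrite big_nat prodr_ge0 // => j /andP[_ jb].
  by rewrite subr_ge0 ler_weXn2l ?(ltW p_gt1) //; lia.
by rewrite (big_cat_nat (n := k)) ?(ltnW kb) //= (big_ltn kb) subrr mul0r mulr0.
Qed.

Local Notation mom mu c := (moment_value p u c (size (parts mu)) (weight mu)).

Lemma moment_value_ge0 c b w : 0 <= moment_value p u c b w.
Proof.
rewrite /moment_value; case: ifP => // _.
by rewrite divr_ge0 ?mulr_ge0 ?exprn_ge0 // ltW // upoch_gt0.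
Qed.

Lemma moment_value_addcol c b (ka : intpart) : (size ka <= b)%N ->
  mom (addcol b ka) c
  = \sum_(k < c.+1) column_kernel p u c k b (size ka) * mom ka k.
Proof. by move=> kab; rewrite column_kernel_moment // size_addcol // weight_addcol. Qed.

Variable d : nat.
Let theta := 1 - upoch p u d.

Let theta_ge0 : 0 <= theta.
Proof.
by rewrite subr_ge0 (le_trans (upoch_le p_gt1 u_gt0 u_ltp (leq0n d))) // /upoch big_geq.
Qed.

Lemma truncated_moment_part0_0 L : truncated_moment L 0 part0 = 1.
Proof.
elim: L => [|L IHL].
  rewrite /truncated_moment big_seq1 /column_term /injcount /autcard /= !big_geq // big_ord0.
  by rewrite /poch big_ord0 expr0 !mulr1 !divr1.
rewrite {1}part0_addcol truncated_momentS // big_ord_recl big_ord0 IHL /column_kernel /=.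
by rewrite big_geq // /poch big_ord0 mul0n !expr0 !mulr1 !divr1 addr0.
Qed.

(* The chain of column lengths is absorbed at [0] with probability at least
   [1 - theta] at each step. *)
Lemma truncated_moment_part0_bounds L c : (c <= d)%N ->
  mom part0 c * (1 - theta ^+ L) <= truncated_moment L c part0 <= mom part0 c.
Proof.
have mom0 k : mom part0 k = (pp k * upoch p u k)^-1.
  by rewrite /moment_value /= subn0 expr0 mul1r.
elim: L c => [|L IHL] c cd.
  rewrite expr0 subrr mulr0 /truncated_moment big_seq1 /column_term.
  rewrite /injcount /autcard /= !big_geq // big_ord0 subn0 expr0 !mulr1 divr1 mul1r mom0 invr_ge0 (ltW (pp_gt0 _)) /=.
  rewrite lef_pV2 ?posrE ?mulr_gt0 ?upoch_gt0 // ler_piMr ?(ltW (pp_gt0 _)) //.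
  by apply: le_trans (upoch_le p_gt1 u_gt0 u_ltp (leq0n c)) _; rewrite /upoch big_geq.
have -> : truncated_moment L.+1 c part0
    = \sum_(k < c.+1) column_kernel p u c k 0 0 * truncated_moment L k part0.
  by rewrite {1}part0_addcol truncated_momentS.
have momE : mom part0 c = \sum_(k < c.+1) column_kernel p u c k 0 0 * mom part0 k.
  by rewrite -(@moment_value_addcol c 0 part0) // -part0_addcol.
apply/andP; split; last first.
  rewrite momE; apply: ler_sum => k _; rewrite ler_wpM2l ?column_kernel_ge0 //.
  by have /andP[] := IHL k (leq_trans (ltn_ord k : k <= c)%N cd).
(* The term [k = 0] suffers no loss, as [0] is absorbing. Its share of the moment is
   [upoch c >= upoch d = 1 - theta], which improves [theta ^+ L] to [theta ^+ L.+1]. *)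
apply: (@le_trans _ _ (mom part0 c * (1 - theta ^+ L)
  + theta ^+ L * column_kernel p u c 0 0 0)).
  have -> : column_kernel p u c 0 0 0 = mom part0 c * upoch p u c.
    rewrite mom0 /column_kernel big_geq // subn0 mul0n !expr0 invfM.
    by rewrite mulr1 mulfVK // mulfVK // mul1r.
  rewrite exprS mulrCA -mulrDr ler_wpM2l ?moment_value_ge0 //.
  have : 0 <= theta ^+ L by rewrite exprn_ge0.
  move: (theta ^+ L) => t t0.
  have -> : 1 - theta * t = 1 - t + t * upoch p u d by rewrite /theta; ring.
  by rewrite lerD2l ler_wpM2l // upoch_le.
have m00 : moment_value p u 0 0 0 = 1.
  by have := mom0 0%N; rewrite /= => ->; rewrite /upoch big_geq // /poch big_ord0 mulr1 invr1.
rewrite {1}momE !big_ord_recl /= truncated_moment_part0_0 m00 !mulr1 mulrDl.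
rewrite mulrBr mulr1 addrAC [_ * theta ^+ L]mulrC subrK lerD2l mulr_suml.
apply: ler_sum => k _; rewrite -mulrA ler_wpM2l ?column_kernel_ge0 //.
have kc : (lift ord0 k <= c)%N by rewrite lift0.
by have /andP[] := IHL _ (leq_trans kc cd).
Qed.

Lemma truncated_moment_bounds M L c (mu : intpart) : (largest mu <= M)%N -> (c <= d)%N ->
  mom mu c * (1 - theta ^+ L) <= truncated_moment (M + L) c mu <= mom mu c.
Proof.
elim: M c mu => [|M IHM] c mu; first by move/largest0 ->; exact: truncated_moment_part0_bounds.
rewrite -largest_delcol => muM cd; rewrite -(delcolK mu).
move: (size mu) (delcol mu) (size_delcol mu) muM => b ka kab kaM.
rewrite addSn truncated_momentS // moment_value_addcol // mulr_suml.
suff h (k : 'I_c.+1) : column_kernel p u c k b (size ka) * mom ka k * (1 - theta ^+ L)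
    <= column_kernel p u c k b (size ka) * truncated_moment (M + L) k ka
    <= column_kernel p u c k b (size ka) * mom ka k.
  by apply/andP; split; apply: ler_sum => k _; case/andP: (h k).
have /andP[h1 h2] := IHM k ka kaM (leq_trans (ltn_ord k : k <= c)%N cd).
case: (leqP (size ka) k) => kk.
  by rewrite -mulrA !ler_wpM2l ?column_kernel_ge0.
(* The kernel may be negative here, but [mom ka k] is 0 and both bounds squeeze the truncated moment
   to 0. *)
move: h1 h2; rewrite /moment_value leqNgt kk /= mul0r => h1 h2.
by rewrite (@le_anti _ _ (truncated_moment (M + L) k ka) 0) ?h1 ?h2 // !mulr0 mul0r lexx.
Qed.

Lemma Pdu_surcard (la mu : intpart) : (size la <= d)%N ->
  Pdu p d u la * surcard p la mu = upoch p u d * pp d * column_term d la mu.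
Proof.
move=> lad; rewrite surcardE // /Pdu npartsE lad -/(upoch p u d) /column_term.
have -> : \prod_((d - size la).+1 <= i < d.+1) (1 - 1 / p ^+ i) = pp d / pp (d - size la).
  have E n : pp n = \prod_(1 <= i < n.+1) (1 - 1 / p ^+ i).
    rewrite big_add1 big_mkord /=; apply: eq_bigr => i _.
    by rewrite exprS invfM mul1r.
  rewrite (E d) [in RHS](big_cat_nat (n := (d - size la).+1)) //=; last by lia.
  by rewrite -E [RHS]mulrC mulKf.
by ring.
Qed.

Lemma Pdu_surcard_gt (la mu : intpart) : (d < size la)%N ->
  Pdu p d u la * surcard p la mu = 0.
Proof. by move=> dla; rewrite /Pdu npartsE leqNgt dla mul0r. Qed.

Lemma Pdu_surcard_ge0 (la mu : intpart) : 0 <= Pdu p d u la * surcard p la mu.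
Proof.
case: (leqP (size la) d) => lad; last by rewrite Pdu_surcard_gt.
rewrite Pdu_surcard //; apply: mulr_ge0.
  by rewrite mulr_ge0 ?(ltW (pp_gt0 _)) // ltW // upoch_gt0.
apply: divr_ge0; last exact/ltW/pp_gt0.
apply: divr_ge0; last exact/ltW/autcard_gt0.
by rewrite mulr_ge0 ?exprn_ge0 ?(ltW u_gt0) //; case: (injcount_ge0_eq0 p_gt1 mu la).
Qed.

Lemma moment_valueE mu : upoch p u d * pp d * mom mu d =
  if (nparts mu <= d)%N then u ^+ weight mu * pp d / pp (d - nparts mu) else 0.
Proof.
rewrite npartsE /moment_value; case: ifP => _; last by rewrite mulr0.
by field; rewrite ?pp_neq0 ?upoch_neq0.
Qed.

Lemma Pdu_sum_bounds M L (mu : intpart) : (largest mu <= M)%N ->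
  let S := \sum_(la <- parts_le (M + L) d) Pdu p d u la * surcard p la mu in
  let V := upoch p u d * pp d * mom mu d in
  V * (1 - theta ^+ L) <= S <= V.
Proof.
move=> muM /=.
have -> : \sum_(la <- parts_le (M + L) d) Pdu p d u la * surcard p la mu
    = upoch p u d * pp d * truncated_moment (M + L) d mu.
  rewrite /truncated_moment mulr_sumr; apply: eq_big_seq => la.
  by rewrite mem_parts_le => /andP[_ ?]; rewrite Pdu_surcard.
have C0 : 0 <= upoch p u d * pp d by rewrite mulr_ge0 ?(ltW (pp_gt0 _)) // ltW // upoch_gt0.
have /andP[h1 h2] := truncated_moment_bounds L muM (leqnn d).
by rewrite -mulrA !ler_wpM2l.
Qed.

End Bounds.

(** * Unordered summation over all partitions *)

Lemma ler_sum_support (R : numDomainType) (I : eqType) (s1 s2 : seq I) (f : I -> R) :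
  uniq s1 -> uniq s2 -> (forall x, 0 <= f x) ->
  (forall x, x \in s1 -> f x != 0 -> x \in s2) ->
  \sum_(x <- s1) f x <= \sum_(x <- s2) f x.
Proof.
move=> u1 u2 f0 sub; rewrite (bigID (mem s2)) /= [X in _ + X]big1_seq ?addr0; last first.
  by move=> x /andP[xs2 xs1]; apply: contraNeq xs2; exact: sub.
rewrite -big_filter (perm_big [seq x <- s2 | x \in s1]) /=; last first.
  apply: uniq_perm; rewrite ?filter_uniq // => x.
  by rewrite !mem_filter andbC.
rewrite big_filter [leRHS](bigID (mem s1)) /= lerDl sumr_ge0 //.
Qed.

Lemma partial_sum_seq (I : choiceType) (V : zmodType) (x : I -> V) (A : {fset I}) :
  partial_sum x A = \sum_(i <- A) x i.
Proof. by rewrite /partial_sum big_seq_fsetE. Qed.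

Theorem theorem5p3 (R : realType) (p u : R) (d : nat) (mu : intpart)
    (p_gt1 : 1 < p) (u_gt0 : 0 < u) (u_ltp : u < p) (d_gt0 : (0 < d)%N) :
  partial_sum (fun la : intpart => Pdu p d u la * surcard p la mu) @ totally -->
    (if (nparts mu <= d)%N then
       u ^+ weight mu * poch p p^-1 d / poch p p^-1 (d - nparts mu)
     else 0).
Proof.
rewrite -(moment_valueE p_gt1 u_gt0 u_ltp).
set V := _ * moment_value _ _ _ _ _; set f := fun la : intpart => _.
have f0 la : 0 <= f la by exact: Pdu_surcard_ge0.
(* Partitions with more than [d] parts contribute 0, and the others in [B] lie in one truncation. *)
have ub (B : {fset intpart}) : partial_sum f B <= V.
  pose L := (\max_(la <- B) largest la)%N.
  have /andP[_] := Pdu_sum_bounds p_gt1 u_gt0 u_ltp d L (leqnn (largest mu)).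
  apply: le_trans; rewrite partial_sum_seq.
  apply: ler_sum_support; rewrite ?parts_le_uniq ?fset_uniq //.
  move=> la laB fla; rewrite mem_parts_le; apply/andP; split; last first.
    by rewrite leqNgt; apply: contra fla => dla; rewrite /f Pdu_surcard_gt.
  apply: leq_trans (leq_addl _ _); rewrite /L.
  exact: (@leq_bigmax_seq _ (enum_fset B) xpredT largest).
pose theta := 1 - upoch p u d.
have th : `|theta| < 1.
  have h1 := upoch_gt0 p_gt1 u_gt0 u_ltp d.
  have h2 := upoch_le p_gt1 u_gt0 u_ltp (leq0n d).
  rewrite {2}/upoch big_geq // in h2.
  by rewrite ger0_norm /theta; lra.
have FF : ProperFilter (@totally intpart) := totally_filter.
apply/cvgrPdist_le => e e0.
have : (fun L => V * theta ^+ L) @ \oo --> V * 0 by apply: cvgMr; exact: cvg_expr.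
rewrite mulr0 => /cvgrPdist_le /(_ e e0)[L _ /(_ L (leqnn _))].
rewrite /= sub0r normrN => hL.
(* Every finite set containing this truncation has a sum of at least [V * (1 - theta ^+ L)], where
   [V * theta ^+ L] is at most [e]. *)
exists [fset la in parts_le (largest mu + L) d]%fset => // B /= AB.
rewrite ger0_norm ?subr_ge0 //.
have /andP[lb _] := Pdu_sum_bounds p_gt1 u_gt0 u_ltp d L (leqnn (largest mu)).
rewrite lerBlDr -lerBlDl; apply: (@le_trans _ _ (V * (1 - theta ^+ L))).
  rewrite mulrBr mulr1 lerD2l lerN2; exact: le_trans (ler_norm _) hL.
apply: le_trans lb _; rewrite partial_sum_seq.
apply: ler_sum_support; rewrite ?parts_le_uniq ?fset_uniq //.
by move=> la lap _; apply: (fsubsetP AB); rewrite !inE.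
Qed.
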